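(* Let $\mathcal E$ be an elementary topos and let $(X,r)$ be an internal order in $\mathcal E$, i.e. a relation $r\colon R\rightarrowtail X\times X$ that is internally reflexive and transitive. Then the power object $PX$, together with the interior operator $\mathsf{int}\colon PX\to PX$ (as the comonad) and the closure operator $\mathsf{cl}\colon PX\to PX$ (as the monad), is a categorical order model of (IS4).
   Context: Topos notation. $\top\colon 1\to\Omega$ is the subobject classifier. $PX$ is the power object of $X$ with membership morphism $\in_X\colon X\times PX\to\Omega$; each $f\colon X\times Y\to\Omega$ has a unique transpose $\hat f\colon Y\to PX$ with $\in_X\circ(1\times\hat f)=f$. For $f\colon A\to B$, the inverse image $Pf\colon PB\to PA$ is the transpose of $\in_B\circ(f\times 1)\colon A\times PB\to\Omega$. The direct image $\exists_f\colon PA\to PB$ is the transpose of the classifying morphism of the image of $(f\times 1)m\colon U_A\to B\times PA$, where $m\colon U_A\rightarrowtail A\times PA$ is the subobject classified by $\in_A$. Each $PX$ is an internal Heyting algebra; its order is the equalizer of the meet $\wedge\colon PX\times PX\to PX$ and the first projection, and for $f,g\colon W\to PX$ one writes $f\le g$ when $\langle f,g\rangle$ factors through this order. Relations. A relation $(X,r)$ is a monomorphism $r\colon R\rightarrowtail X\times X$, with classifying morphism $\le_r\colon X\times X\to\Omega$; $r^\dagger$ is $r$ with the two factors of $X\times X$ interchanged. It is reflexive if $\Delta_X\le r$ and transitive if $r\otimes r\le r$ ($\otimes$ is composition of relations via pullback and image; $\le$ is inclusion of subobjects). An order (internal preorder) is a reflexive and transitive relation. The downsegment morphism $\downarrow\colon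 X\to PX$ is the transpose of $\le_r$, so that $(a\in_X\downarrow b)=(a\le_r b)$; the upsegment morphism $\uparrow\colon X\to PX$ is the transpose of the classifying morphism of $r^\dagger$, so that $(a\in_X\uparrow b)=(b\le_r a)$. The object $PX$ with its own order has a downsegment morphism $\downarrow\colon PX\to P^2X$, and this has an internal left adjoint $\bigvee\colon P^2X\to PX$ (the internal join). Operators. $\mathsf{int}:=P(\uparrow)\circ\downarrow\colon PX\to P^2X\to PX$ (with $\uparrow\colon X\to PX$ and $\downarrow\colon PX\to P^2X$), and $\mathsf{cl}:=\bigvee\circ\exists_{\downarrow}\colon PX\to P^2X\to PX$ (with $\downarrow\colon X\to PX$). Comonads and monads. A comonad on a preordered object is an order-preserving endomorphism $d$ with $d\le 1$ and $d\le dd$; a monad is an order-preserving endomorphism $t$ with $1\le t$ and $tt\le t$. A categorical order model of (IS4) is an internal preorder in $\mathcal E$ that, viewed as an internal category, is cartesian closed with (finite) coproducts, together with a comonad $d$ that is (lax) cartesian monoidal, i.e. $d(a)\wedge d(b)\le d(a\wedge b)$ and $\top\le d(\top)$ for generalized elements $a,b$, and a monad $t$ that is $d$-strong, i.e. $d(a)\wedge t(b)\le t(d(a)\wedge b)$ for all generalized elements $a,b$. (All coherence conditions are vacuous for a preorder.) *)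

(* Defs.v *)
From Corelib Require Import ssreflect.
From Stdlib Require Import Setoid.

Set Implicit Arguments.
Unset Strict Implicit.
Unset Printing Implicit Defensive.

Record Category := {
  Ob :> Type;
  Hom : Ob -> Ob -> Type;
  idm : forall A, Hom A A;
  comp : forall A B C, Hom B C -> Hom A B -> Hom A C;
  comp1m : forall A B (f : Hom A B), comp (idm B) f = f;
  compm1 : forall A B (f : Hom A B), comp f (idm A) = f;
  compA : forall A B C D (h : Hom C D) (g : Hom B C) (f : Hom A B),
    comp h (comp g f) = comp (comp h g) f }.

Arguments Hom {c} _ _.
Arguments idm {c} _.
Arguments comp {c A B C} _ _.

Notation "g ∘ f" := (comp g f) (at level 40, left associativity).

Definition mono {C : Category} {A B : C} (m : Hom A B) : Prop :=
  forall W (u v : Hom W A), m ∘ u = m ∘ v -> u = v.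

(* For monomorphisms f and m this is the inclusion f <= m of subobjects. *)
Definition factors {C : Category} {W A B : C} (f : Hom W B) (m : Hom A B) : Prop :=
  exists h : Hom W A, m ∘ h = f.

Definition is_pullback {C : Category} {P A B D : C}
    (p : Hom P A) (q : Hom P B) (f : Hom A D) (g : Hom B D) : Prop :=
  f ∘ p = g ∘ q /\
  forall W (u : Hom W A) (v : Hom W B), f ∘ u = g ∘ v ->
    exists! h : Hom W P, p ∘ h = u /\ q ∘ h = v.

Record ElementaryTopos := {
  cat :> Category;
  one : cat;
  bang : forall A, Hom A one;
  bang_unique : forall A (f : Hom A one), f = bang A;
  prd : cat -> cat -> cat;
  pr1 : forall A B, Hom (prd A B) A;
  pr2 : forall A B, Hom (prd A B) B;
  pairing : forall W A B, Hom W A -> Hom W B -> Hom W (prd A B);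
  pr1_pairing : forall W A B (f : Hom W A) (g : Hom W B), pr1 A B ∘ pairing f g = f;
  pr2_pairing : forall W A B (f : Hom W A) (g : Hom W B), pr2 A B ∘ pairing f g = g;
  pairing_unique : forall W A B (h : Hom W (prd A B)),
    h = pairing (pr1 A B ∘ h) (pr2 A B ∘ h);
  eqz : forall A B (f g : Hom A B), cat;
  eqz_mor : forall A B (f g : Hom A B), Hom (eqz f g) A;
  eqz_eq : forall A B (f g : Hom A B), f ∘ eqz_mor f g = g ∘ eqz_mor f g;
  eqz_mono : forall A B (f g : Hom A B), mono (eqz_mor f g);
  eqz_lift : forall A B (f g : Hom A B) W (h : Hom W A),
    f ∘ h = g ∘ h -> Hom W (eqz f g);
  eqz_mor_lift : forall A B (f g : Hom A B) W (h : Hom W A) (e : f ∘ h = g ∘ h),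
    eqz_mor f g ∘ eqz_lift e = h;
  Omega : cat;
  truth : Hom one Omega;
  char : forall U A (m : Hom U A), mono m -> Hom A Omega;
  char_pullback : forall U A (m : Hom U A) (hm : mono m),
    is_pullback m (bang U) (char hm) truth;
  char_unique : forall U A (m : Hom U A) (hm : mono m) (c : Hom A Omega),
    is_pullback m (bang U) c truth -> c = char hm;
  pow : cat -> cat;
  mem : forall A, Hom (prd A (pow A)) Omega;
  transpose : forall A B, Hom (prd A B) Omega -> Hom B (pow A);
  mem_transpose : forall A B (f : Hom (prd A B) Omega),
    mem A ∘ pairing (pr1 A B) (transpose f ∘ pr2 A B) = f;
  transpose_unique : forall A B (f : Hom (prd A B) Omega) (g : Hom B (pow A)),
    mem A ∘ pairing (pr1 A B) (g ∘ pr2 A B) = f -> g = transpose f }.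

Arguments one {_}.
Arguments bang {_} _.
Arguments prd {_} _ _.
Arguments pr1 {_ A B}.
Arguments pr2 {_ A B}.
Arguments pairing {_ W A B} _ _.
Arguments eqz {_ A B} _ _.
Arguments eqz_mor {_ A B} _ _.
Arguments eqz_lift {_ A B f g W h} _.
Arguments Omega {_}.
Arguments truth {_}.
Arguments char {_ U A m} _.
Arguments pow {_} _.
Arguments mem {_ A}.
Arguments transpose {_ A B} _.

Notation "A × B" := (prd A B) (at level 40, left associativity).
Notation "⟨ f , g ⟩" := (pairing f g).

Section Constructions.
Context {E : ElementaryTopos}.
Implicit Types A B D W X Y Z : E.

Definition prd_mor {A A' B B' : E} (f : Hom A A') (g : Hom B B') :
  Hom (A × B) (A' × B') := ⟨f ∘ pr1, g ∘ pr2⟩.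

Definition swap {A B : E} : Hom (A × B) (B × A) := ⟨pr2, pr1⟩.

Lemma pairing_comp V W A B (f : Hom W A) (g : Hom W B) (v : Hom V W) :
  ⟨f, g⟩ ∘ v = ⟨f ∘ v, g ∘ v⟩.
Proof. by rewrite [LHS]pairing_unique !compA pr1_pairing pr2_pairing. Qed.

Lemma pairing_inj W A B (f f' : Hom W A) (g g' : Hom W B) :
  ⟨f, g⟩ = ⟨f', g'⟩ -> f = f' /\ g = g'.
Proof.
move=> e; split.
- by rewrite -(pr1_pairing f g) e pr1_pairing.
- by rewrite -(pr2_pairing f g) e pr2_pairing.
Qed.

Lemma pr12_id A B : ⟨pr1, pr2⟩ = idm (A × B).
Proof. by rewrite [RHS]pairing_unique !compm1. Qed.

Lemma swapK A B : swap ∘ swap = idm (A × B).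
Proof. by rewrite /swap pairing_comp pr1_pairing pr2_pairing pr12_id. Qed.

Lemma swap_mono {R A B : E} (r : Hom R (A × B)) : mono r -> mono (swap ∘ r).
Proof.
move=> hr W u v e; apply: hr.
have: swap ∘ (swap ∘ r ∘ u) = swap ∘ (swap ∘ r ∘ v) by rewrite e.
by rewrite !compA swapK !comp1m.
Qed.

Lemma point_mono {A : E} (a : Hom one A) : mono a.
Proof. by move=> W u v _; rewrite (bang_unique u) (bang_unique v). Qed.

Arguments point_mono {A} a.

Definition pb {A B D : E} (f : Hom A D) (g : Hom B D) : E :=
  eqz (f ∘ @pr1 E A B) (g ∘ pr2).
Definition pb1 {A B D : E} (f : Hom A D) (g : Hom B D) : Hom (pb f g) A :=
  pr1 ∘ eqz_mor (f ∘ pr1) (g ∘ pr2).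
Definition pb2 {A B D : E} (f : Hom A D) (g : Hom B D) : Hom (pb f g) B :=
  pr2 ∘ eqz_mor (f ∘ pr1) (g ∘ pr2).

Lemma pb_is_pullback A B D (f : Hom A D) (g : Hom B D) :
  is_pullback (pb1 f g) (pb2 f g) f g.
Proof.
split; first by rewrite /pb1 /pb2 !compA eqz_eq.
move=> W u v e.
have e' : f ∘ pr1 ∘ ⟨u, v⟩ = g ∘ pr2 ∘ ⟨u, v⟩.
  by rewrite -!compA pr1_pairing pr2_pairing.
exists (eqz_lift e'); split.
  by rewrite /pb1 /pb2 -!compA eqz_mor_lift pr1_pairing pr2_pairing.
move=> h [hu hv]; apply: (@eqz_mono E); rewrite eqz_mor_lift.
by rewrite [RHS]pairing_unique !compA -/(pb1 f g) -/(pb2 f g) hu hv.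
Qed.

Definition holds {W : E} (p : Hom W Omega) : Prop := p = truth ∘ bang W.

Lemma holds_comp V W (p : Hom W Omega) (v : Hom V W) : holds p -> holds (p ∘ v).
Proof. by rewrite /holds => ->; rewrite -compA [bang W ∘ v]bang_unique. Qed.

Lemma holds_char U A (m : Hom U A) (hm : mono m) W (a : Hom W A) :
  holds (char hm ∘ a) <-> factors a m.
Proof.
have [e u] := char_pullback hm; split.
- by move=> /u [h [[h1 _] _]]; exists h.
- by move=> [h <-]; rewrite compA e; rewrite /holds -compA [bang U ∘ h]bang_unique.
Qed.

Lemma Omega_ext W (p q : Hom W Omega) :
  (forall V (v : Hom V W), holds (p ∘ v) <-> holds (q ∘ v)) -> p = q.
Proof.
move=> e; set m := eqz_mor p (truth ∘ bang W).
have hm : mono m by apply: eqz_mono.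
have hp : holds (p ∘ m).
  by rewrite /holds eqz_eq -compA [bang W ∘ m]bang_unique.
have lift V (v : Hom V W) : holds (p ∘ v) ->
    exists! h, m ∘ h = v /\ bang _ ∘ h = bang V.
  move=> hv; have ev : p ∘ v = truth ∘ bang W ∘ v.
    by rewrite hv -compA [bang W ∘ v]bang_unique.
  exists (eqz_lift ev); split; last first.
    by move=> h [hv' _]; apply: hm; rewrite eqz_mor_lift.
  by split; [apply: eqz_mor_lift | apply: bang_unique].
transitivity (char hm); [|symmetry]; apply: char_unique; split.
- exact: hp.
- by move=> V v t; rewrite (bang_unique t) => /lift.
- exact/e.
- by move=> V v t; rewrite (bang_unique t) => /e /lift.
Qed.

Lemma mem_transposeE A B W (f : Hom (A × B) Omega) (a : Hom W A) (b : Hom W B) :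
  mem ∘ ⟨a, transpose f ∘ b⟩ = f ∘ ⟨a, b⟩.
Proof.
rewrite -[in RHS](mem_transpose f) -compA pairing_comp pr1_pairing -compA.
by rewrite pr2_pairing.
Qed.

Lemma pow_ext A W (S T : Hom W (pow A)) :
  (forall V (v : Hom V W) (a : Hom V A),
     holds (mem ∘ ⟨a, S ∘ v⟩) <-> holds (mem ∘ ⟨a, T ∘ v⟩)) -> S = T.
Proof.
move=> e; rewrite (transpose_unique (g := S) eq_refl); symmetry.
apply: transpose_unique; apply: Omega_ext => V v.
by rewrite -!compA !pairing_comp -!compA; split=> /e.
Qed.

(* The image of f is the least subobject through which f factors. *)
Record Image {A B : E} (f : Hom A B) := {
  im : E;
  im_mor : Hom im B;
  im_mono : mono im_mor;
  im_factors : factors f im_mor;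
  im_least : forall M (m : Hom M B), mono m -> factors f m -> factors im_mor m }.

Arguments im {A B f} _.
Arguments im_mor {A B f} _.
Arguments im_mono {A B f} _.

Definition inverse_image {A B : E} (f : Hom A B) : Hom (pow B) (pow A) :=
  transpose (mem ∘ prd_mor f (idm (pow B))).

Lemma mem_inverse_image A B (f : Hom A B) W (a : Hom W A) (S : Hom W (pow B)) :
  mem ∘ ⟨a, inverse_image f ∘ S⟩ = mem ∘ ⟨f ∘ a, S⟩.
Proof.
rewrite mem_transposeE -compA /prd_mor pairing_comp -!compA pr1_pairing.
by rewrite pr2_pairing comp1m.
Qed.

(* The image of f consists of the b that belong to every S in PB such that
   (Pf)(S) is the whole of A. *)
Definition image {A B : E} (f : Hom A B) : Image f.
Proof.
pose all D W : Hom W (pow D) := transpose (truth ∘ bang (D × W)).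
have allE D W (S : Hom W (pow D)) : S = all D W <->
    forall V (v : Hom V W) (a : Hom V D), holds (mem ∘ ⟨a, S ∘ v⟩).
  have hall V (v : Hom V W) (a : Hom V D) : holds (mem ∘ ⟨a, all D W ∘ v⟩).
    by rewrite mem_transposeE; apply: holds_comp.
  split=> [-> // | hS]; apply: pow_ext => V v a; split=> _ //.
pose k := eqz_mor (inverse_image f) (all A (pow B)).
pose g : Hom B (pow (eqz (inverse_image f) (all A (pow B)))) :=
  transpose (mem ∘ ⟨pr2, k ∘ pr1⟩).
have gE W (b : Hom W B) s : mem ∘ ⟨s, g ∘ b⟩ = mem ∘ ⟨b, k ∘ s⟩.
  by rewrite mem_transposeE -compA pairing_comp -compA pr1_pairing pr2_pairing.
have all_comp D V W (v : Hom V W) : all D W ∘ v = all D V.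
  by apply/allE => U u a; rewrite -compA mem_transposeE; apply: holds_comp.
exists (eqz g (all _ B)) (eqz_mor g (all _ B)).
- exact: eqz_mono.
- suff e : g ∘ f = all _ B ∘ f by exists (eqz_lift e); rewrite eqz_mor_lift.
  rewrite all_comp; apply/allE => V v s; rewrite -compA gE -mem_inverse_image.
  by rewrite compA eqz_eq all_comp mem_transposeE; apply: holds_comp.
- move=> M m hm [h hf]; apply/(holds_char hm).
  pose S : Hom one (pow B) := transpose (char hm ∘ pr1).
  have eS : inverse_image f ∘ S = all _ _ ∘ S.
    rewrite all_comp; apply/allE => V v a.
    rewrite -compA mem_inverse_image mem_transposeE -compA pr1_pairing.
    by apply/holds_char; exists (h ∘ a); rewrite compA hf.
  set i := eqz_mor g _.
  have hi : g ∘ i = all _ _ by rewrite eqz_eq all_comp.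
  move/allE: hi => /(_ _ (idm _) (eqz_lift eS ∘ bang _)).
  by rewrite compm1 gE compA eqz_mor_lift mem_transposeE -compA pr1_pairing.
Defined.

Definition direct_image {A B : E} (f : Hom A B) : Hom (pow A) (pow B) :=
  transpose (char (im_mono (image
    (prd_mor f (idm (pow A)) ∘ pb1 (@mem E A) truth)))).

Definition Omega_and : Hom (Omega × Omega) (@Omega E) :=
  char (point_mono ⟨truth, truth⟩).

Lemma holds_and W (p q : Hom W Omega) :
  holds (Omega_and ∘ ⟨p, q⟩) <-> holds p /\ holds q.
Proof.
rewrite /Omega_and holds_char; split.
- by move=> [h]; rewrite (bang_unique h) pairing_comp => /pairing_inj [<- <-].
- by move=> [-> ->]; exists (bang W); rewrite pairing_comp.
Qed.

Definition pow_meet (X : E) : Hom (pow X × pow X) (pow X) :=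
  transpose (Omega_and ∘ ⟨mem ∘ ⟨pr1, pr1 ∘ pr2⟩, mem ∘ ⟨pr1, pr2 ∘ pr2⟩⟩).

Record Relation (X : E) := {
  rel : E;
  rel_mor : Hom rel (X × X);
  rel_mono : mono rel_mor }.

Arguments rel {X} _.
Arguments rel_mor {X} _.
Arguments rel_mono {X} _.

Definition rel_char {X : E} (r : Relation X) : Hom (X × X) Omega :=
  char (rel_mono r).

Definition rel_le {X W : E} (r : Relation X) (a b : Hom W X) : Prop :=
  factors ⟨a, b⟩ (rel_mor r).

Definition dagger {X : E} (r : Relation X) : Relation X :=
  {| rel_mono := swap_mono (rel_mono r) |}.

Definition rel_comp {X : E} (r s : Relation X) : Relation X :=
  let p := pb1 (pr2 ∘ rel_mor r) (pr1 ∘ rel_mor s) in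
  let q := pb2 (pr2 ∘ rel_mor r) (pr1 ∘ rel_mor s) in
  {| rel_mono := im_mono (image ⟨pr1 ∘ rel_mor r ∘ p, pr2 ∘ rel_mor s ∘ q⟩) |}.

Definition rel_reflexive {X : E} (r : Relation X) : Prop :=
  factors ⟨idm X, idm X⟩ (rel_mor r).

Definition rel_transitive {X : E} (r : Relation X) : Prop :=
  factors (rel_mor (rel_comp r r)) (rel_mor r).

Definition internal_order {X : E} (r : Relation X) : Prop :=
  rel_reflexive r /\ rel_transitive r.

Definition downseg {X : E} (r : Relation X) : Hom X (pow X) :=
  transpose (rel_char r).

Definition upseg {X : E} (r : Relation X) : Hom X (pow X) :=
  transpose (rel_char (dagger r)).

Definition pow_le (X : E) : Relation (pow X) :=
  {| rel_mor := eqz_mor (pow_meet X) pr1; rel_mono := @eqz_mono _ _ _ _ _ |}.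

Lemma pow_leP X W (S T : Hom W (pow X)) :
  rel_le (pow_le X) S T <->
  forall V (v : Hom V W) (x : Hom V X),
    holds (mem ∘ ⟨x, S ∘ v⟩) -> holds (mem ∘ ⟨x, T ∘ v⟩).
Proof.
have meetE V (v : Hom V W) (x : Hom V X) :
    holds (mem ∘ ⟨x, pow_meet X ∘ ⟨S, T⟩ ∘ v⟩) <->
    holds (mem ∘ ⟨x, S ∘ v⟩) /\ holds (mem ∘ ⟨x, T ∘ v⟩).
  rewrite -compA mem_transposeE pairing_comp -compA pairing_comp holds_and.
  by rewrite -!compA !pairing_comp -!compA !(pr1_pairing, pr2_pairing).
have -> : rel_le (pow_le X) S T <-> pow_meet X ∘ ⟨S, T⟩ = S.
  split=> [[h /= e] | e]; first by rewrite -e compA eqz_eq -compA e pr1_pairing.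
  have e' : pow_meet X ∘ ⟨S, T⟩ = pr1 ∘ ⟨S, T⟩ by rewrite e pr1_pairing.
  by exists (eqz_lift e'); apply: eqz_mor_lift.
split=> [e V v x | le_ST].
- by rewrite -{1}e => /meetE [].
- by apply: pow_ext => V v x; rewrite meetE; split=> [[] // | ?]; split; auto.
Qed.

Definition internal_left_adjoint {Y Z : E} (s : Relation Y) (s' : Relation Z)
    (l : Hom Z Y) (u : Hom Y Z) : Prop :=
  forall W (z : Hom W Z) (y : Hom W Y), rel_le s (l ∘ z) y <-> rel_le s' z (u ∘ y).

Lemma mem_downseg X (r : Relation X) W (a b : Hom W X) :
  holds (mem ∘ ⟨a, downseg r ∘ b⟩) <-> rel_le r a b.
Proof. by rewrite mem_transposeE; apply: holds_char. Qed.

(* The join of a family S in PPX is the set of all x that belong to every T in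
   PX such that S is contained in the downsegment of T. *)
Definition pow_join_sig (X : E) :
  { join : Hom (pow (pow X)) (pow X) |
    internal_left_adjoint (pow_le X) (pow_le (pow X)) join (downseg (pow_le X)) }.
Proof.
pose bounds W (S : Hom W (pow (pow X))) (T : Hom W (pow X)) : Hom W Omega :=
  rel_char (pow_le (pow X)) ∘ ⟨S, downseg (pow_le X) ∘ T⟩.
have boundsP W S T : holds (bounds W S T) <->
    rel_le (pow_le (pow X)) S (downseg (pow_le X) ∘ T) by apply: holds_char.
have bounds_comp V W (v : Hom V W) S T :
    bounds W S T ∘ v = bounds V (S ∘ v) (T ∘ v).
  by rewrite /bounds -compA pairing_comp -compA.
pose phi : Hom (pow X × (X × pow (pow X))) Omega := bounds _ (pr2 ∘ pr2) pr1.
pose psi : Hom (pow X × (X × pow (pow X))) Omega := mem ∘ ⟨pr1 ∘ pr2, pr1⟩.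
pose alpha := transpose phi.
pose beta := transpose (Omega_and ∘ ⟨phi, psi⟩).
exists (transpose (char (@eqz_mono _ _ _ alpha beta))).
set join := transpose _.
have joinP W (x : Hom W X) (S : Hom W (pow (pow X))) :
    holds (mem ∘ ⟨x, join ∘ S⟩) <->
    forall V (v : Hom V W) (T : Hom V (pow X)),
      rel_le (pow_le (pow X)) (S ∘ v) (downseg (pow_le X) ∘ T) ->
      holds (mem ∘ ⟨x ∘ v, T⟩).
{ have aE V (v : Hom V W) (T : Hom V (pow X)) :
      mem ∘ ⟨T, alpha ∘ ⟨x, S⟩ ∘ v⟩ = bounds V (S ∘ v) T.
    rewrite -compA pairing_comp mem_transposeE bounds_comp -compA.
    by rewrite !(pr1_pairing, pr2_pairing).
  have bE V (v : Hom V W) (T : Hom V (pow X)) :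
      mem ∘ ⟨T, beta ∘ ⟨x, S⟩ ∘ v⟩ =
      Omega_and ∘ ⟨bounds V (S ∘ v) T, mem ∘ ⟨x ∘ v, T⟩⟩.
    rewrite -compA pairing_comp mem_transposeE -compA pairing_comp bounds_comp.
    rewrite /psi -!compA pairing_comp -!compA.
    by rewrite !(pr1_pairing, pr2_pairing).
  rewrite mem_transposeE holds_char; split.
  - move=> [h e] V v T /boundsP hT.
    have eab : alpha ∘ ⟨x, S⟩ = beta ∘ ⟨x, S⟩ by rewrite -e !compA eqz_eq.
    by move: hT; rewrite -aE eab bE holds_and => -[].
  - move=> hx; have eab : alpha ∘ ⟨x, S⟩ = beta ∘ ⟨x, S⟩.
      apply: pow_ext => V v T; rewrite aE bE holds_and.
      by split=> [hT | [] //]; split=> //; apply/hx/boundsP.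
    by exists (eqz_lift eab); apply: eqz_mor_lift. }
move=> W z y; split.
- move/pow_leP=> h; apply/pow_leP=> V v S hS.
  rewrite -compA mem_downseg; apply/pow_leP=> U u x hx.
  rewrite -compA; apply: h; rewrite -compA; apply/joinP=> U' u' T hT.
  move/pow_leP: hT => /(_ _ (idm _) (S ∘ u ∘ u')).
  have -> : mem ∘ ⟨S ∘ u ∘ u', z ∘ (v ∘ u) ∘ u' ∘ idm U'⟩ =
            mem ∘ ⟨S, z ∘ v⟩ ∘ (u ∘ u').
    by rewrite compm1 -!compA pairing_comp -!compA.
  move=> /(_ (holds_comp _ hS)); rewrite compm1 mem_downseg.
  move/pow_leP=> /(_ _ (idm _) (x ∘ u')); rewrite !compm1; apply.
  have -> : ⟨x ∘ u', S ∘ u ∘ u'⟩ = ⟨x, S ∘ u⟩ ∘ u' by rewrite pairing_comp.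
  by rewrite compA; apply: holds_comp.
- move=> h; apply/pow_leP=> V v x.
  rewrite -compA => /joinP /(_ _ (idm _) (y ∘ v)); rewrite !compm1; apply.
  move: h => [k e]; exists (k ∘ v).
  by rewrite compA e pairing_comp -compA.
Defined.

Definition pow_join (X : E) : Hom (pow (pow X)) (pow X) :=
  proj1_sig (pow_join_sig X).

Definition interior {X : E} (r : Relation X) : Hom (pow X) (pow X) :=
  inverse_image (upseg r) ∘ downseg (pow_le X).

Definition closure {X : E} (r : Relation X) : Hom (pow X) (pow X) :=
  pow_join X ∘ direct_image (downseg r).

Definition order_preserving {Y : E} (s : Relation Y) (f : Hom Y Y) : Prop :=
  forall W (a b : Hom W Y), rel_le s a b -> rel_le s (f ∘ a) (f ∘ b).

Definition is_comonad {Y : E} (s : Relation Y) (d : Hom Y Y) : Prop :=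
  order_preserving s d /\ rel_le s d (idm Y) /\ rel_le s d (d ∘ d).

Definition is_monad {Y : E} (s : Relation Y) (t : Hom Y Y) : Prop :=
  order_preserving s t /\ rel_le s (idm Y) t /\ rel_le s (t ∘ t) t.

(* Cartesian closed structure and finite coproducts, as internal operations
   whose universal properties are stated on generalized elements. *)
Record is_bicartesian_closed {Y : E} (s : Relation Y)
    (top bot : Hom one Y) (meet join imp : Hom (Y × Y) Y) : Prop := {
  le_top : forall W (a : Hom W Y), rel_le s a (top ∘ bang W);
  le_meet : forall W (c a b : Hom W Y),
    rel_le s c (meet ∘ ⟨a, b⟩) <-> rel_le s c a /\ rel_le s c b;
  le_imp : forall W (c a b : Hom W Y),
    rel_le s c (imp ∘ ⟨a, b⟩) <-> rel_le s (meet ∘ ⟨c, a⟩) b;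
  bot_le : forall W (a : Hom W Y), rel_le s (bot ∘ bang W) a;
  join_le : forall W (a b c : Hom W Y),
    rel_le s (join ∘ ⟨a, b⟩) c <-> rel_le s a c /\ rel_le s b c }.

Definition lax_monoidal {Y : E} (s : Relation Y) (top : Hom one Y)
    (meet : Hom (Y × Y) Y) (d : Hom Y Y) : Prop :=
  (forall W (a b : Hom W Y),
     rel_le s (meet ∘ ⟨d ∘ a, d ∘ b⟩) (d ∘ (meet ∘ ⟨a, b⟩))) /\
  rel_le s top (d ∘ top).

Definition strong {Y : E} (s : Relation Y) (meet : Hom (Y × Y) Y)
    (d t : Hom Y Y) : Prop :=
  forall W (a b : Hom W Y),
    rel_le s (meet ∘ ⟨d ∘ a, t ∘ b⟩) (t ∘ (meet ∘ ⟨d ∘ a, b⟩)).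

Definition IS4_order_model {Y : E} (s : Relation Y) (d t : Hom Y Y) : Prop :=
  internal_order s /\
  exists (top bot : Hom one Y) (meet join imp : Hom (Y × Y) Y),
    is_bicartesian_closed s top bot meet join imp /\
    is_comonad s d /\ lax_monoidal s top meet d /\
    is_monad s t /\ strong s meet d t.

End Constructions.

(* Main.v *)
From Corelib Require Import ssreflect.
Require Import Defs.

(** In the Kripke-Joyal semantics [int S = {x | forall y >= x, y in S}], while
    [cl S] is determined by its left adjointness: [cl S <= T] holds iff
    [y <= x in S] implies [y in T].  The first description gives the comonad laws
    from reflexivity and transitivity.  The second gives the monad laws, and it
    turns strength [int a /\ cl b <= cl (int a /\ b)], after moving [int a] across
    the Heyting implication, into: if [y <= x in b] and [y in int a] then
    [x in int a], because [int a] is up-closed. *)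

Set Implicit Arguments.
Unset Strict Implicit.
Unset Printing Implicit Defensive.

Section Semantics.
Context {E : ElementaryTopos}.
Implicit Types A B D U V W X Y : E.

(** * Relations on generalized elements *)

Lemma rel_le_comp Y (s : Relation Y) V W (a b : Hom W Y) (v : Hom V W) :
  rel_le s a b -> rel_le s (a ∘ v) (b ∘ v).
Proof. by move=> [h e]; exists (h ∘ v); rewrite compA e pairing_comp. Qed.

Lemma dagger_le Y (s : Relation Y) W (a b : Hom W Y) :
  rel_le (dagger s) a b <-> rel_le s b a.
Proof.
split=> -[h e]; exists h; last first.
  by rewrite /= -compA e /swap pairing_comp pr1_pairing pr2_pairing.
rewrite -[LHS]comp1m -swapK -compA [swap ∘ (_ ∘ h)]compA e.
by rewrite /swap pairing_comp pr1_pairing pr2_pairing.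
Qed.

Lemma rel_le_refl Y (s : Relation Y) W (a : Hom W Y) :
  rel_reflexive s -> rel_le s a a.
Proof. by move=> /(rel_le_comp a); rewrite comp1m. Qed.

(** Two composable pairs give a point of the pullback behind [rel_comp s s], and its image in the
    composite lies in [s] by transitivity. *)
Lemma rel_le_trans Y (s : Relation Y) W (a b c : Hom W Y) :
  rel_transitive s -> rel_le s a b -> rel_le s b c -> rel_le s a c.
Proof.
move=> [t et] [h eh] [k ek].
have e : pr2 ∘ rel_mor s ∘ h = pr1 ∘ rel_mor s ∘ k.
  by rewrite -!compA eh ek pr1_pairing pr2_pairing.
have [l [[lh lk] _]] := proj2 (pb_is_pullback _ _) _ _ _ e.
have [i ei] := im_factors (image
  ⟨pr1 ∘ rel_mor s ∘ pb1 (pr2 ∘ rel_mor s) (pr1 ∘ rel_mor s),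
   pr2 ∘ rel_mor s ∘ pb2 (pr2 ∘ rel_mor s) (pr1 ∘ rel_mor s)⟩).
exists (t ∘ (i ∘ l)); rewrite compA et /= compA ei pairing_comp.
rewrite -(compA _ (pb1 _ _)) lh -(compA _ (pb2 _ _)) lk -!compA eh ek.
by rewrite pr1_pairing pr2_pairing.
Qed.

(** Since an image is the least subobject, transitivity need only be checked on the pullback, whose
    legs are two related pairs with a common middle term. *)
Lemma pow_le_order X : internal_order (pow_le X).
Proof.
split; first by apply/pow_leP.
apply: im_least; first exact: rel_mono.
set f := pr2 ∘ _; set g := pr1 ∘ _.
apply/pow_leP => V v x hx.
have le_rel W (h : Hom W (rel (pow_le X))) :
    rel_le (pow_le X) (pr1 ∘ rel_mor (pow_le X) ∘ h)
      (pr2 ∘ rel_mor (pow_le X) ∘ h).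
  by exists h; rewrite [LHS]pairing_unique !compA.
have /pow_leP /(_ _ _ _ hx) := le_rel _ (pb1 f g).
rewrite -/f (proj1 (pb_is_pullback f g)).
by have /pow_leP := le_rel _ (pb2 f g); apply.
Qed.

(** * Internal logic: implication, universal quantifier, equality, images *)

(** This classifies the order of Ω: p entails q iff p ∧ q = p. *)
Definition Omega_imp : Hom (Omega × Omega) (@Omega E) :=
  char (@eqz_mono _ _ _ Omega_and pr1).

Lemma holds_imp W (p q : Hom W Omega) :
  holds (Omega_imp ∘ ⟨p, q⟩) <->
  forall V (v : Hom V W), holds (p ∘ v) -> holds (q ∘ v).
Proof.
have -> : holds (Omega_imp ∘ ⟨p, q⟩) <-> Omega_and ∘ ⟨p, q⟩ = p.
  rewrite holds_char; split=> [[h e] | e].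
    by rewrite -e compA eqz_eq -compA e pr1_pairing.
  have e' : Omega_and ∘ ⟨p, q⟩ = pr1 ∘ ⟨p, q⟩ by rewrite pr1_pairing.
  by exists (eqz_lift e'); apply: eqz_mor_lift.
split=> [e V v | h].
  by rewrite -{1}e -compA pairing_comp holds_and => -[].
apply: Omega_ext => V v; rewrite -compA pairing_comp holds_and.
by split=> [[] // | ?]; split; auto.
Qed.

(** Classifies those b whose set of all a with [p] is the whole of A. *)
Definition Omega_all A B (p : Hom (A × B) Omega) : Hom B Omega :=
  char (@eqz_mono _ _ _ (transpose p) (transpose (truth ∘ bang (A × B)))).

Lemma holds_all A B (p : Hom (A × B) Omega) W (b : Hom W B) :
  holds (Omega_all p ∘ b) <->
  forall V (v : Hom V W) (a : Hom V A), holds (p ∘ ⟨a, b ∘ v⟩).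
Proof.
have hT V (u : Hom V (A × B)) : holds (truth ∘ bang (A × B) ∘ u).
  exact: holds_comp.
rewrite holds_char; split=> [[h e] V v a | h].
  by rewrite -mem_transposeE -e compA compA eqz_eq -!compA mem_transposeE.
have e : transpose p ∘ b = transpose (truth ∘ bang (A × B)) ∘ b.
  by apply: pow_ext => V v a; rewrite -!compA !mem_transposeE; split.
by exists (eqz_lift e); apply: eqz_mor_lift.
Qed.

Lemma diag_mono A : mono ⟨idm A, idm A⟩.
Proof.
by move=> W u v; rewrite !pairing_comp !comp1m => /pairing_inj [].
Qed.

Lemma holds_eq A W (a b : Hom W A) :
  holds (char (@diag_mono A) ∘ ⟨a, b⟩) <-> a = b.
Proof.
rewrite holds_char; split=> [[h] | ->].
  by rewrite pairing_comp comp1m => /pairing_inj [<- <-].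
by exists b; rewrite pairing_comp comp1m.
Qed.

(* The least-subobject property of an image only concerns elements of B; the
   parameter w : V -> W is absorbed by quantifying over W internally. *)
Lemma image_ind A B (f : Hom A B) W (p q : Hom (W × B) Omega) :
  (forall V (w : Hom V W) (a : Hom V A),
     holds (p ∘ ⟨w, f ∘ a⟩) -> holds (q ∘ ⟨w, f ∘ a⟩)) ->
  forall V (w : Hom V W) (b : Hom V B), factors b (im_mor (image f)) ->
    holds (p ∘ ⟨w, b⟩) -> holds (q ∘ ⟨w, b⟩).
Proof.
move=> hf V w b [h <-].
set j := im_mor _.
pose m := eqz_mor (Omega_all (Omega_imp ∘ ⟨p, q⟩)) (truth ∘ bang B).
have hm : mono m by apply: eqz_mono.
have [k ek] : factors j m.
  apply: im_least => //.
  have e : Omega_all (Omega_imp ∘ ⟨p, q⟩) ∘ f = truth ∘ bang B ∘ f.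
    rewrite -compA [bang B ∘ f]bang_unique; apply/holds_all => U u a.
    rewrite -compA pairing_comp; apply/holds_imp => U' u'.
    by rewrite -!compA pairing_comp -!compA; apply: hf.
  by exists (eqz_lift e); apply: eqz_mor_lift.
have: holds (Omega_all (Omega_imp ∘ ⟨p, q⟩) ∘ (j ∘ h)).
  rewrite -ek [_ ∘ (m ∘ k ∘ h)]compA [_ ∘ (m ∘ k)]compA eqz_eq.
  by do 3!apply: holds_comp.
move/holds_all => /(_ _ (idm _) w); rewrite compm1 -compA pairing_comp.
by move/holds_imp => /(_ _ (idm _)); rewrite !compm1.
Qed.

(** * Adjunctions and the semantics of the two operators *)

Lemma direct_image_le A B (f : Hom A B) W (S : Hom W (pow A)) (T : Hom W (pow B)) :
  rel_le (pow_le B) (direct_image f ∘ S) T <->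
  rel_le (pow_le A) S (inverse_image f ∘ T).
Proof.
rewrite !pow_leP; split=> h V v x.
- move=> hx; rewrite -compA mem_inverse_image; apply: h.
  rewrite -compA mem_transposeE; apply/holds_char.
  have [k [[ek _] _]] := proj2 (pb_is_pullback (@mem E A) truth) _ _ _ hx.
  have [i ei] := im_factors (image
    (prd_mor f (idm (pow A)) ∘ pb1 (@mem E A) truth)).
  exists (i ∘ k); rewrite compA ei -compA ek /prd_mor pairing_comp -!compA.
  by rewrite pr1_pairing pr2_pairing comp1m.
- rewrite -compA mem_transposeE => /holds_char hx.
  (* The image lives in B × PA, so the induction must carry its second component: [p] says that it
     equals S, [q] that the first component lies in T. *)
  pose p : Hom (W × (B × pow A)) Omega :=
    char (@diag_mono (pow A)) ∘ ⟨S ∘ pr1, pr2 ∘ pr2⟩.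
  pose q : Hom (W × (B × pow A)) Omega := mem ∘ ⟨pr1 ∘ pr2, T ∘ pr1⟩.
  have pE U (w : Hom U W) (c : Hom U (B × pow A)) :
      holds (p ∘ ⟨w, c⟩) <-> S ∘ w = pr2 ∘ c.
    rewrite /p -compA pairing_comp -!compA pr1_pairing pr2_pairing.
    exact: holds_eq.
  have qE U (w : Hom U W) (c : Hom U (B × pow A)) :
      q ∘ ⟨w, c⟩ = mem ∘ ⟨pr1 ∘ c, T ∘ w⟩.
    by rewrite /q -compA pairing_comp -!compA pr1_pairing pr2_pairing.
  suff: holds (q ∘ ⟨v, ⟨x, S ∘ v⟩⟩) by rewrite qE pr1_pairing.
  apply: (image_ind _ hx); last by apply/pE; rewrite pr2_pairing.
  move=> U w a /pE; rewrite qE /prd_mor.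
  (* [c] is a pair (a', S') with a' in S'; once [p] identifies S' with S at this stage, [h]
     applies. *)
  set c := pb1 _ _ ∘ a.
  rewrite -(compA _ _ a) -/c pairing_comp pr1_pairing pr2_pairing comp1m => e.
  rewrite -compA -mem_inverse_image compA; apply: h.
  rewrite e -pairing_unique /c compA (proj1 (pb_is_pullback _ _)) -compA.
  by rewrite /holds [_ ∘ a]bang_unique.
Qed.

Lemma mem_interior X (r : Relation X) W (x : Hom W X) (S : Hom W (pow X)) :
  holds (mem ∘ ⟨x, interior r ∘ S⟩) <->
  forall V (v : Hom V W) (y : Hom V X),
    rel_le r (x ∘ v) y -> holds (mem ∘ ⟨y, S ∘ v⟩).
Proof.
have upE V (v : Hom V W) (y : Hom V X) :
    holds (mem ∘ ⟨y, upseg r ∘ x ∘ v⟩) <-> rel_le r (x ∘ v) y.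
  by rewrite -compA mem_transposeE /rel_char holds_char; apply: dagger_le.
rewrite -compA mem_inverse_image mem_downseg pow_leP.
by split=> h V v y; move: (h V v y); rewrite upE.
Qed.

(** Composing ⋁ ⊣ ↓ with ∃_↓ ⊣ P(↓) makes [closure r] left adjoint to P(↓) ∘ ↓, which sends T to the
    set of all x with ↓x ≤ T. *)
Lemma closure_le X (r : Relation X) W (S T : Hom W (pow X)) :
  rel_le (pow_le X) (closure r ∘ S) T <->
  forall V (v : Hom V W) (x y : Hom V X),
    holds (mem ∘ ⟨x, S ∘ v⟩) -> rel_le r y x -> holds (mem ∘ ⟨y, T ∘ v⟩).
Proof.
have -> : rel_le (pow_le X) (closure r ∘ S) T <->
    rel_le (pow_le X) S (inverse_image (downseg r) ∘ (downseg (pow_le X) ∘ T)).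
  rewrite -direct_image_le -compA; exact: (proj2_sig (pow_join_sig X)).
have memE V (v : Hom V W) (x : Hom V X) :
    holds (mem ∘ ⟨x, inverse_image (downseg r) ∘ (downseg (pow_le X) ∘ T) ∘ v⟩)
    <-> rel_le (pow_le X) (downseg r ∘ x) (T ∘ v).
  by rewrite -compA mem_inverse_image -compA mem_downseg.
rewrite pow_leP; split=> h V v x.
- move=> y hx hy.
  have /memE /pow_leP /(_ _ (idm V) y) := h V v x hx.
  by rewrite !compm1 mem_downseg; apply.
- move=> hx; apply/memE/pow_leP => U u y; rewrite -compA mem_downseg -compA.
  apply: h; have := holds_comp u hx.
  by rewrite -compA pairing_comp -compA.
Qed.

(** * The Heyting algebra structure of PX *)

Lemma mem_meet X W (x : Hom W X) (S T : Hom W (pow X)) :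
  holds (mem ∘ ⟨x, pow_meet X ∘ ⟨S, T⟩⟩) <->
  holds (mem ∘ ⟨x, S⟩) /\ holds (mem ∘ ⟨x, T⟩).
Proof.
rewrite mem_transposeE -compA pairing_comp holds_and.
by rewrite -!compA !pairing_comp -!compA !(pr1_pairing, pr2_pairing).
Qed.

Definition pow_top X : Hom one (pow X) := transpose (truth ∘ bang (X × one)).

Lemma mem_top X W (x : Hom W X) (u : Hom W one) :
  holds (mem ∘ ⟨x, pow_top X ∘ u⟩).
Proof. by rewrite mem_transposeE; apply: holds_comp. Qed.

Definition pow_imp X : Hom (pow X × pow X) (pow X) :=
  transpose (Omega_imp ∘ ⟨mem ∘ ⟨pr1, pr1 ∘ pr2⟩, mem ∘ ⟨pr1, pr2 ∘ pr2⟩⟩).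

Lemma mem_imp X W (x : Hom W X) (S T : Hom W (pow X)) :
  holds (mem ∘ ⟨x, pow_imp X ∘ ⟨S, T⟩⟩) <->
  forall V (v : Hom V W),
    holds (mem ∘ ⟨x ∘ v, S ∘ v⟩) -> holds (mem ∘ ⟨x ∘ v, T ∘ v⟩).
Proof.
rewrite mem_transposeE -compA pairing_comp holds_imp.
rewrite -!compA !pairing_comp -!compA !(pr1_pairing, pr2_pairing).
by split=> h V v; move: (h V v); rewrite -!compA !pairing_comp.
Qed.

Lemma pow_le_imp X W (S T T' : Hom W (pow X)) :
  rel_le (pow_le X) S (pow_imp X ∘ ⟨T, T'⟩) <->
  rel_le (pow_le X) (pow_meet X ∘ ⟨S, T⟩) T'.
Proof.
rewrite !pow_leP; split=> h V v x.
- rewrite -compA pairing_comp mem_meet => -[/h].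
  rewrite -compA pairing_comp mem_imp => /(_ _ (idm V)).
  by rewrite !compm1; apply.
- move=> hx; rewrite -compA pairing_comp; apply/mem_imp => U u hu.
  rewrite -compA; apply: h; rewrite -compA pairing_comp; apply/mem_meet.
  split; last by rewrite compA.
  (* Membership in S persists along the change of stage [u]. *)
  by have := holds_comp u hx; rewrite -compA pairing_comp -compA.
Qed.

Lemma pow_le_meet X W (S T T' : Hom W (pow X)) :
  rel_le (pow_le X) S (pow_meet X ∘ ⟨T, T'⟩) <->
  rel_le (pow_le X) S T /\ rel_le (pow_le X) S T'.
Proof.
rewrite !pow_leP; split=> [h | [h h'] V v x hx].
  by split=> V v x /h; rewrite -compA pairing_comp mem_meet => -[].
by rewrite -compA pairing_comp; apply/mem_meet; split; auto.
Qed.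

(* Finite joins are defined impredicatively, as the sets of all x that belong to
   every upper bound. *)
Definition pow_bot X : Hom one (pow X) :=
  transpose (Omega_all (mem ∘ ⟨pr1 ∘ pr2, pr1⟩)).

Lemma pow_bot_le X W (S : Hom W (pow X)) :
  rel_le (pow_le X) (pow_bot X ∘ bang W) S.
Proof.
apply/pow_leP => V v x; rewrite -compA mem_transposeE.
move/holds_all => /(_ _ (idm V) (S ∘ v)).
by rewrite compm1 -compA pairing_comp -compA pr2_pairing !pr1_pairing.
Qed.

Definition pow_bin_join X : Hom (pow X × pow X) (pow X) :=
  let le S := rel_char (pow_le X) ∘ ⟨S ∘ (pr2 ∘ pr2), pr1⟩ in
  transpose (Omega_all (Omega_imp ∘
    ⟨Omega_and ∘ ⟨le pr1, le pr2⟩, mem ∘ ⟨pr1 ∘ pr2, pr1⟩⟩)).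

Lemma mem_bin_join X W (x : Hom W X) (S T : Hom W (pow X)) :
  holds (mem ∘ ⟨x, pow_bin_join X ∘ ⟨S, T⟩⟩) <->
  forall V (v : Hom V W) (Z : Hom V (pow X)),
    rel_le (pow_le X) (S ∘ v) Z -> rel_le (pow_le X) (T ∘ v) Z ->
    holds (mem ∘ ⟨x ∘ v, Z⟩).
Proof.
rewrite mem_transposeE holds_all.
(* [p] says that Z bounds S and T, [q] that x belongs to Z. *)
set p := Omega_and ∘ _; set q := mem ∘ _.
have pE V (v : Hom V W) (Z : Hom V (pow X)) : holds (p ∘ ⟨Z, ⟨x, ⟨S, T⟩⟩ ∘ v⟩) <->
    rel_le (pow_le X) (S ∘ v) Z /\ rel_le (pow_le X) (T ∘ v) Z.
  have leE (a : Hom (pow X × pow X) (pow X)) :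
      holds (rel_char (pow_le X) ∘ ⟨a ∘ (pr2 ∘ pr2), pr1⟩ ∘ ⟨Z, ⟨x, ⟨S, T⟩⟩ ∘ v⟩)
      <-> rel_le (pow_le X) (a ∘ ⟨S, T⟩ ∘ v) Z.
    rewrite -[_ ∘ _ ∘ ⟨Z, _⟩]compA pairing_comp -!(compA a) -compA pr1_pairing.
    by rewrite pr2_pairing (compA pr2) pr2_pairing; apply: holds_char.
  by rewrite /p -compA pairing_comp holds_and !leE pr1_pairing pr2_pairing.
have qE V (v : Hom V W) (Z : Hom V (pow X)) :
    q ∘ ⟨Z, ⟨x, ⟨S, T⟩⟩ ∘ v⟩ = mem ∘ ⟨x ∘ v, Z⟩.
  rewrite /q -compA pairing_comp -compA !(pr1_pairing, pr2_pairing) compA.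
  by rewrite pr1_pairing.
split=> h V v Z.
- move=> hS hT; rewrite -qE.
  move: (h V v Z); rewrite -compA pairing_comp.
  by move/holds_imp => /(_ _ (idm V)); rewrite !compm1 pE; apply.
- rewrite -compA pairing_comp; apply/holds_imp => U u.
  rewrite -!(compA _ _ u) pairing_comp -(compA _ v u) qE => /pE [hS hT].
  exact: h.
Qed.

(** Elements of S or T lie in every common upper bound; conversely, Z is itself one of the bounds
    quantified over. *)
Lemma pow_bin_join_le X W (S T Z : Hom W (pow X)) :
  rel_le (pow_le X) (pow_bin_join X ∘ ⟨S, T⟩) Z <->
  rel_le (pow_le X) S Z /\ rel_le (pow_le X) T Z.
Proof.
split=> [/pow_leP h | [hS hT]].
- split; apply/pow_leP => V v x hx; apply: h; rewrite -compA pairing_comp;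
    apply/mem_bin_join => U u Z' hS hT;
    [move/pow_leP: hS | move/pow_leP: hT] => /(_ _ (idm U) (x ∘ u));
    rewrite !compm1; apply; rewrite -pairing_comp compA; exact: holds_comp.
- apply/pow_leP => V v x; rewrite -compA pairing_comp.
  move/mem_bin_join => /(_ _ (idm V) (Z ∘ v)); rewrite !compm1.
  by apply; apply: rel_le_comp.
Qed.

Lemma pow_bicartesian_closed X :
  is_bicartesian_closed (pow_le X) (pow_top X) (pow_bot X) (pow_meet X)
    (pow_bin_join X) (pow_imp X).
Proof.
split.
- by move=> W S; apply/pow_leP => V v x _; rewrite -compA; apply: mem_top.
- exact: pow_le_meet.
- exact: pow_le_imp.
- exact: pow_bot_le.
- exact: pow_bin_join_le.
Qed.

(** * The comonad and monad laws, and strength *)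

Section Operators.
Context {X : E} {r : Relation X} (hr : internal_order r).

Let refl W (x : Hom W X) : rel_le r x x.
Proof. by apply: rel_le_refl; case: hr. Qed.

Let trans W (x y z : Hom W X) : rel_le r x y -> rel_le r y z -> rel_le r x z.
Proof. by apply: rel_le_trans; case: hr. Qed.

Let mem_comp V W (v : Hom V W) (x : Hom W X) (S : Hom W (pow X)) :
  holds (mem ∘ ⟨x, S⟩) -> holds (mem ∘ ⟨x ∘ v, S ∘ v⟩).
Proof. by move=> /(holds_comp v); rewrite -compA pairing_comp. Qed.

(** By transitivity, whatever is above y is above x. *)
Lemma interior_upclosed W (x y : Hom W X) (S : Hom W (pow X)) :
  holds (mem ∘ ⟨x, interior r ∘ S⟩) -> rel_le r x y ->
  holds (mem ∘ ⟨y, interior r ∘ S⟩).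
Proof.
move=> /mem_interior h hxy; apply/mem_interior => V v z hz; apply: h.
by apply: trans hz; apply: rel_le_comp.
Qed.

Lemma interior_mono : order_preserving (pow_le X) (interior r).
Proof.
move=> W S T /pow_leP hST; apply/pow_leP => V v x.
rewrite -!(compA (interior r)) => /mem_interior h; apply/mem_interior => U u y /h.
by rewrite -!compA; apply: hST.
Qed.

Lemma interior_comonad : is_comonad (pow_le X) (interior r).
Proof.
split; first exact: interior_mono.
(* Both inequalities are between endomorphisms of PX, so the change of stage is itself a generalized
   element [S] of PX. *)
split; apply/pow_leP => V S x.
- move=> /mem_interior /(_ _ (idm V) x); rewrite !compm1 comp1m; apply.
  exact: refl.
- move=> h; rewrite -compA; apply/mem_interior => U u y hy.
  rewrite -compA; apply: interior_upclosed hy.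
  by rewrite compA; apply: mem_comp.
Qed.

Lemma interior_lax_monoidal :
  lax_monoidal (pow_le X) (pow_top X) (pow_meet X) (interior r).
Proof.
split=> [W S T|]; apply/pow_leP => V v x.
- rewrite -!(compA _ _ v) !pairing_comp -!(compA _ _ v) mem_meet !mem_interior.
  move=> -[hS hT] U u y hy.
  by rewrite -compA pairing_comp; apply/mem_meet; split; auto.
- move=> _; rewrite -compA; apply/mem_interior => U u y _.
  by rewrite -compA; apply: mem_top.
Qed.

(** The unit of the adjunction: [closure_le] with T taken to be [closure r ∘ S]. *)
Lemma closure_unit W (S : Hom W (pow X)) :
  forall V (v : Hom V W) (x y : Hom V X),
    holds (mem ∘ ⟨x, S ∘ v⟩) -> rel_le r y x ->
    holds (mem ∘ ⟨y, closure r ∘ S ∘ v⟩).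
Proof. by apply/closure_le; apply: rel_le_refl; case: (pow_le_order X). Qed.

(* [closure r] is left adjoint to [interior (dagger r)]. *)
Lemma closure_downclosed W (x y : Hom W X) (S : Hom W (pow X)) :
  holds (mem ∘ ⟨x, closure r ∘ S⟩) -> rel_le r y x ->
  holds (mem ∘ ⟨y, closure r ∘ S⟩).
Proof.
move=> hx hy.
(* By the adjunction it is enough to treat b ≤ a with a in S; then c ≤ b gives c ≤ a, so c is in the
   closure. *)
have /pow_leP /(_ _ (idm W) x) : rel_le (pow_le X) (closure r ∘ S)
    (interior (dagger r) ∘ (closure r ∘ S)).
  apply/closure_le => V v a b ha hb; rewrite -(compA (interior _)).
  apply/mem_interior => U u c /dagger_le hc.
  rewrite -(compA _ v u); apply: (closure_unit (x := a ∘ u)).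
    by rewrite compA; apply: mem_comp.
  by apply: trans hc _; apply: rel_le_comp.
rewrite !compm1 => /(_ hx) /mem_interior /(_ _ (idm W) y).
by rewrite !compm1; apply; apply/dagger_le.
Qed.

Lemma closure_monad : is_monad (pow_le X) (closure r).
Proof.
split; [|split].
- move=> W S T /pow_leP hST; apply/closure_le => V v x y /hST.
  exact: closure_unit.
- apply/pow_leP => V S x; rewrite comp1m => hx.
  rewrite -(compm1 (closure r)); apply: (closure_unit (x := x)) => //.
  by rewrite comp1m.
(* Transposed along the adjunction, the multiplication law is exactly down-closure of cl S. *)
- apply/closure_le => V S x y; exact: closure_downclosed.
Qed.

Lemma interior_closure_strong :
  strong (pow_le X) (pow_meet X) (interior r) (closure r).
Proof.
move=> W S T; apply/pow_leP => V v x.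
rewrite -compA pairing_comp => /mem_meet [hS hT].
set C := closure r ∘ _.
have /pow_leP /(_ _ _ _ hT) :
    rel_le (pow_le X) (closure r ∘ T) (pow_imp X ∘ ⟨interior r ∘ S, C⟩).
  apply/closure_le => U u y z hy hzy.
  rewrite -compA pairing_comp; apply/mem_imp => U' u' hz.
  have hzy' := rel_le_comp u' hzy.
  (* The element of int S ∧ T above z is y itself: it is in T, and it inherits int S from z. *)
  rewrite -compA; apply: closure_unit (hzy'); rewrite -compA pairing_comp.
  apply/mem_meet; split; last by rewrite compA; apply: mem_comp.
  rewrite -!(compA (interior r)) in hz; rewrite -(compA (interior r)) (compA S).
  exact: interior_upclosed hz hzy'.
rewrite -compA pairing_comp => /mem_imp /(_ _ (idm V)).
by rewrite !compm1; apply.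
Qed.

End Operators.
End Semantics.

Theorem theorem3p18 (E : ElementaryTopos) (X : E) (r : Relation X)
    (hr : internal_order r) :
  IS4_order_model (pow_le X) (interior r) (closure r).
Proof.
split; first exact: pow_le_order.
exists (pow_top X), (pow_bot X), (pow_meet X), (pow_bin_join X), (pow_imp X).
split; first exact: pow_bicartesian_closed.
split; first exact: interior_comonad.
split; first exact: interior_lax_monoidal.
split; first exact: closure_monad.
exact: interior_closure_strong.
Qed.
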